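(* Consider the Labouchere system with any initial list and winning probability $p=\frac12$ at each coup. Then $\mathbb{E}[B^\star]=\infty$.
   Context: A gambler plays a sequence of independent coups, each won with probability $p$ and lost with probability $1-p$. The Labouchere system: the bettor chooses a nonempty finite initial list $L_0$ of positive real numbers. At each coup the bet size equals the sum of the first and last numbers on the current list (if only one number remains on the list, the bet size equals that number). After a win, the first and last numbers are canceled from the list (if only one number remains, it is canceled); after a loss, the amount just lost is appended to the end of the list. The system continues until the list is empty. Let $L_n$ be the list after the $n$-th coup, $B_n$ the bet size at the $n$-th coup, and $N$ the first $n$ with $L_n=\varnothing$ (possibly $N=\infty$). The largest bet size is $B^\star=\max_{1\le n\le N}B_n$ if $N<\infty$, and $B^\star=\sup_{n\ge1}B_n$ if $N=\infty$. *)

(* Defs.v *)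
From HB Require Import structures.
From mathcomp Require Import all_boot all_order all_algebra.
From mathcomp Require Import all_classical all_reals all_analysis.

Set Implicit Arguments.
Unset Strict Implicit.
Unset Printing Implicit Defensive.

Import Order.TTheory GRing.Theory Num.Theory.
Import numFieldNormedType.Exports.

Local Open Scope classical_set_scope.
Local Open Scope ring_scope.

(* Mutual independence of a sequence of random variables: the product rule for
   every finite subfamily of indices. *)
Definition mutually_independent (R : realType) (d d' : measure_display)
    (T : measurableType d) (T' : measurableType d') (P : probability T R)
    (X : nat -> {RV P >-> T'}) : Prop :=
  forall (J : seq nat) (A : nat -> set T'),
    uniq J -> (forall i, measurable (A i)) ->
    P (\bigcap_(i in [set` J]) (X i @^-1` A i)) =
    (\prod_(i <- J) P (X i @^-1` A i))%E.

(* [W n] is the outcome of coup number n + 1 ([true] for a win). *)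
Definition independent_coups (R : realType) (d : measure_display)
    (T : measurableType d) (P : probability T R) (p : R)
    (W : nat -> {RV P >-> bool}) : Prop :=
  mutually_independent W /\ forall n, P (W n @^-1` [set true]) = p%:E.

Section Labouchere.
Variable R : realType.
Implicit Types (l : seq R) (s : nat -> bool).

(* The value on the empty list is never used as a bet of the system. *)
Definition bet_size l : R :=
  match l with
  | [::] => 0
  | [:: x] => x
  | x :: y :: l' => x + last y l'
  end.

Definition cancel_ends l : seq R :=
  match l with
  | [::] => [::]
  | [:: _] => [::]
  | _ :: y :: l' => belast y l'
  end.

(* Play stops at the empty list, which is therefore left unchanged. *)
Definition next_list l (win : bool) : seq R :=
  if l is [::] then [::]
  else if win then cancel_ends l else rcons l (bet_size l).

(* The list L_n after the n-th coup; [s n] is the outcome of coup n + 1. *)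
Fixpoint lab_list (L0 : seq R) s (n : nat) : seq R :=
  if n is m.+1 then next_list (lab_list L0 s m) (s m) else L0.

(* The bet size B_n at the n-th coup, for n >= 1: it is read off L_(n-1). *)
Definition lab_bet (L0 : seq R) s (n : nat) : R :=
  bet_size (lab_list L0 s n.-1).

(* N, the first n with L_n empty; the infimum of the empty set is +oo. *)
Definition lab_time (L0 : seq R) s : \bar R :=
  ereal_inf [set n%:R%:E | n in [set n : nat | lab_list L0 s n = [::]]].

(* B*, the supremum of the B_n over 1 <= n <= N: a maximum if N is finite, and
   the supremum over all n >= 1 if N = +oo. *)
Definition lab_max_bet (L0 : seq R) s : \bar R :=
  ereal_sup [set (lab_bet L0 s n)%:E |
    n in [set n : nat | (1 <= n)%N /\ (n%:R%:E <= lab_time L0 s)%E]].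

End Labouchere.

(* Main.v *)
Require Import Defs.
From HB Require Import structures.
From mathcomp Require Import all_boot all_order all_algebra.
From mathcomp Require Import all_classical all_reals all_analysis.
From mathcomp Require Import measurable_realfun ring lra.

Set Implicit Arguments.
Unset Strict Implicit.
Unset Printing Implicit Defensive.

Import Order.TTheory GRing.Theory Num.Theory.
Import numFieldNormedType.Exports.

Local Open Scope classical_set_scope.
Local Open Scope ring_scope.

(* Let S_n be the sum of the list after n coups and M_n the largest bet up to
   then (or S_0 if larger). The game being fair, S_n is a nonnegative martingale
   that vanishes once play stops, and play lasts longer than n coups with
   probability O(rho^n) for some rho < 1, so S_n lives on exponentially small
   events and the entropy E[S_n ln S_n] grows linearly in n. Since S_n is at
   most (n + 1) M_n, so does y_n := E[S_n ln M_n]. On the other hand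
   M_(n+1) - M_n >= M_n (ln M_(n+1) - ln M_n)
                 >= S_(n+1) (ln M_(n+1) - ln M_n) / (n + 2),
   and S_n being a martingale, the expectation of the right-hand side is
   (y_(n+1) - y_n) / (n + 2). Summation by parts makes E[M_n] grow at least
   like the harmonic series. *)

(** * Averages over all outcome sequences of a given length *)

Fixpoint paths (n : nat) : seq (seq bool) :=
  if n is m.+1 then flatten [seq [:: rcons s true; rcons s false] | s <- paths m]
  else [:: [::]].

Lemma size_paths n s : s \in paths n -> size s = n.
Proof.
elim: n s => [|n IH] s /=; first by rewrite inE => /eqP ->.
case/flatten_mapP => t /IH tn; rewrite !inE.
by case/orP => /eqP ->; rewrite size_rcons tn.
Qed.

Section Mean.
Variable R : realType.
Implicit Types (F G : seq bool -> R).

Definition mean n F : R := (\sum_(s <- paths n) F s) / 2 ^+ n.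

Lemma mean0 F : mean 0 F = F [::].
Proof. by rewrite /mean big_seq1 divr1. Qed.

Lemma sum_pathsS n F :
  \sum_(s <- paths n.+1) F s =
  \sum_(s <- paths n) (F (rcons s true) + F (rcons s false)).
Proof.
rewrite /= big_flatten /= big_map; apply: eq_bigr => s _.
by rewrite !big_cons big_nil addr0.
Qed.

(** The inner average is the conditional expectation given the first [n] outcomes, so martingale
    arguments reduce to one-step computations. *)
Lemma meanS n F :
  mean n.+1 F = mean n (fun s => (F (rcons s true) + F (rcons s false)) / 2).
Proof. by rewrite /mean sum_pathsS -mulr_suml exprS invfM mulrA. Qed.

Lemma meanD n F G : mean n (fun s => F s + G s) = mean n F + mean n G.
Proof. by rewrite /mean big_split mulrDl. Qed.

Lemma meanZ n a F : mean n (fun s => a * F s) = a * mean n F.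
Proof. by rewrite /mean -mulr_sumr mulrA. Qed.

Lemma meanB n F G : mean n (fun s => F s - G s) = mean n F - mean n G.
Proof.
by rewrite meanD; congr (_ + _); rewrite /mean sumrN mulNr.
Qed.

Lemma mean_cst n a : mean n (fun=> a) = a.
Proof.
elim: n => [|n IH]; first exact: mean0.
by rewrite meanS -[RHS]IH; congr mean; apply/funext => s; lra.
Qed.

Lemma eq_mean n F G : (forall s, size s = n -> F s = G s) -> mean n F = mean n G.
Proof.
by move=> FG; congr (_ / _); apply: eq_big_seq => s /size_paths /FG.
Qed.

Lemma le_mean n F G : (forall s, size s = n -> F s <= G s) -> mean n F <= mean n G.
Proof.
move=> FG; rewrite ler_wpM2r ?invr_ge0 ?exprn_ge0//.
by rewrite big_seq [leRHS]big_seq; apply: ler_sum => s /size_paths /FG.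
Qed.

(** Each outcome sequence occurs exactly once in [paths n]. *)
Lemma sum_paths_delta n (w : nat -> bool) F :
  \sum_(s <- paths n) F s * (mkseq w n == s)%:R = F (mkseq w n).
Proof.
elim: n F => [|n IH] F; first by rewrite big_seq1 eqxx mulr1.
rewrite sum_pathsS mkseqS -(IH (fun s => F (rcons s (w n)))).
apply: eq_bigr => s _; rewrite !eqseq_rcons.
by case: (w n); rewrite /= ?andbT ?andbF /= ?mulr0 ?addr0 ?add0r.
Qed.
End Mean.

(** * From integrals over the coups to finite averages *)

Section Integral.
Context (R : realType) (d : measure_display) (T : measurableType d).

(** The integral of a nonnegative function is a supremum over the simple functions below it. This
    spares a measurability proof for [lab_max_bet]. *)
Lemma ge0_le_integral_nonmeasurable (mu : {measure set T -> \bar R})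
    (f g : T -> \bar R) :
  (forall x, 0 <= f x)%E -> (forall x, f x <= g x)%E ->
  (\int[mu]_x f x <= \int[mu]_x g x)%E.
Proof.
move=> f0 fg; have g0 x : (0 <= g x)%E := le_trans (f0 x) (fg x).
rewrite !ge0_integralTE//; apply: ereal_sup_le => _ [h hf <-].
by exists h => // x; exact: le_trans (hf x) (fg x).
Qed.

Context (P : probability T R) (W : nat -> {RV P >-> bool}).
Hypothesis hW : independent_coups 2^-1 W.

Lemma probability_coup n b : P (W n @^-1` [set b]) = (2^-1)%:E.
Proof.
case: hW => _ Wt; case: b; first exact: Wt.
have -> : W n @^-1` [set false] = ~` (W n @^-1` [set true]).
  by apply/seteqP; split => x /=; case: (W n x).
rewrite probability_setC ?Wt; last exact: measurable_funPTI.
by rewrite -EFinB; congr _%:E; lra.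
Qed.

Definition coups_event n (s : seq bool) : set T :=
  [set w | mkseq (fun i => W i w) n = s].

Lemma coups_eventE n s : size s = n ->
  coups_event n s =
  \bigcap_(i in [set` iota 0 n]) (W i @^-1` [set nth false s i]).
Proof.
move=> sn; apply/seteqP; split => w /=.
  by move=> <- i /=; rewrite mem_iota => /andP[_ ?]; rewrite nth_mkseq.
move=> sw; apply: (@eq_from_nth _ false); rewrite size_mkseq// => i ni.
by rewrite nth_mkseq// (sw i)//= mem_iota.
Qed.

Lemma measurable_coups_event n s : measurable (coups_event n s).
Proof.
have [sn|sn] := eqVneq (size s) n.
  rewrite coups_eventE//; apply: fin_bigcap_measurable => // i _.
  exact: measurable_funPTI.
rewrite (_ : coups_event n s = set0)// -subset0 => w /= ws.
by move: sn; rewrite -ws size_mkseq eqxx.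
Qed.

Lemma probability_coups_event n s : size s = n ->
  P (coups_event n s) = ((2 ^+ n)^-1)%:E.
Proof.
move=> sn; rewrite coups_eventE// hW.1 ?iota_uniq//.
under eq_bigr do rewrite probability_coup.
by rewrite -[X in iota 0 X]subn0 prodEFin prodr_const_nat subn0 exprVn.
Qed.

Lemma integral_coups n (F : seq bool -> R) : (forall s, 0 <= F s) ->
  (\int[P]_w (F (mkseq (fun i => W i w) n))%:E = (mean n F)%:E)%E.
Proof.
move=> F0.
(* The integrand is a finite combination of indicators of cylinder events, each of probability
   [2 ^- n] by independence. *)
transitivity (\int[P]_w
    (\sum_(s <- paths n) (F s * \1_(coups_event n s) w)%:E))%E.
  apply: eq_integral => w _; rewrite sumEFin -sum_paths_delta; congr _%:E.
  apply: eq_bigr => s _; rewrite indicE; congr (_ * _%:R).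
  by congr nat_of_bool; apply/eqP/idP; rewrite inE.
rewrite ge0_integral_sum//; first last.
- by move=> s w _; rewrite lee_fin mulr_ge0.
- move=> s; apply/measurable_EFinP; apply: measurable_funM => //.
  exact/measurable_indic/measurable_coups_event.
rewrite /mean mulr_suml -sumEFin; apply: eq_big_seq => s /size_paths sn.
rewrite (integralZl_indic _ (fun=> coups_event n s))//; first last.
- exact: measurable_coups_event.
- by rewrite ltNge F0.
rewrite integral_indic//; last exact: measurable_coups_event.
by rewrite setIT EFinM; congr (_ * _)%E; exact: probability_coups_event.
Qed.
End Integral.

(** * One coup: sum and length of the list *)

Section Lists.
Variable R : realType.
Implicit Types (l : seq R) (w : bool).

Definition positive l := forall x, x \in l -> 0 < x.

Lemma positive_next_list l w : positive l -> positive (next_list l w).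
Proof.
case: l => [|x [|y l]]; case: w => //= pos z.
- by rewrite !inE => /orP[] /eqP ->; apply: pos; rewrite mem_head.
- by move=> /mem_belast zl; apply: pos; rewrite inE zl orbT.
- rewrite -rcons_cons -rcons_cons mem_rcons inE => /orP[/eqP ->|]; last exact: pos.
  by rewrite addr_gt0 ?pos ?mem_head// inE mem_last orbT.
Qed.

Lemma positive_sum_ge0 l : positive l -> 0 <= \sum_(x <- l) x.
Proof. by move=> pos; rewrite big_seq sumr_ge0// => x /pos /ltW. Qed.

Lemma positive_sum_gt0 l : positive l -> l <> [::] -> 0 < \sum_(x <- l) x.
Proof.
case: l => // x l pos _; rewrite big_cons ltr_wpDr ?pos ?mem_head//.
by apply: positive_sum_ge0 => y yl; rewrite pos// inE yl orbT.
Qed.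

Lemma bet_size_ge0 l : positive l -> 0 <= bet_size l.
Proof.
case: l => [|x [|y l]] //= pos; first by rewrite ltW ?pos ?mem_head.
by rewrite addr_ge0 ?ltW ?pos ?mem_head// inE mem_last orbT.
Qed.

Lemma sum_cancel_ends l :
  \sum_(x <- cancel_ends l) x = \sum_(x <- l) x - bet_size l.
Proof.
case: l => [|x [|y l]] /=; first by rewrite big_nil subr0.
  by rewrite big_nil big_seq1 subrr.
rewrite big_cons lastI -cats1 big_cat big_seq1 /=; ring.
Qed.

Lemma sum_next_list l w :
  \sum_(x <- next_list l w) x =
  \sum_(x <- l) x + (if w then - bet_size l else bet_size l).
Proof.
case: l => [|x l]; first by case: w; rewrite /= ?oppr0 addr0.
case: w; first exact: sum_cancel_ends.
by rewrite /next_list -cats1 big_cat big_seq1.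
Qed.

(* With [k] numbers on a list, the drift of the number of numbers is -1/2, so
   an exponential of it is a supermartingale; it dominates the indicator of
   nonempty lists. *)
Definition length_potential l : R := if l is [::] then 0 else (5 / 4) ^+ size l.

Lemma length_potential_ge1 l : l <> [::] -> 1 <= length_potential l.
Proof. by case: l => // x l _; apply: exprn_ege1; lra. Qed.

(** The mean one-step factor for three or more numbers: [((4/5)^2 + 5/4) / 2]. With one or two
    numbers it is smaller, as a win brings the potential to 0. *)
Definition decay : R := 189 / 200.

Lemma length_potential_next_list l :
  length_potential (next_list l true) + length_potential (next_list l false)
  <= 2 * decay * length_potential l.
Proof.
rewrite /decay; case: l => [|x [|y [|z l]]]; rewrite /= ?expr0 ?expr1 ?mulr0 ?addr0//.
- by rewrite add0r expr2; lra.
- by rewrite add0r !exprS expr0; lra.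
rewrite size_rcons size_belast !exprS.
have := exprn_ge0 (size l) (_ : 0 <= 5 / 4 :> R); rewrite divr_ge0// => /(_ isT).
by move: (_ ^+ _) => e; lra.
Qed.
End Lists.

(** * Logarithmic growth from summation by parts *)

Section Logarithm.
Variable R : realType.

Lemma ln_leB1 (x : R) : 0 < x -> ln x <= x - 1.
Proof. by move=> x0; rewrite -{1}(subrKC 1 x) le_ln1Dx//; lra. Qed.

(* Summation by parts; the correction [C / n.+1] makes the lower bound on [y]
   telescope against the increments of [ln n.+2]. *)
Lemma log_growth (e y : nat -> R) (c C : R) : 0 < c ->
  (forall n, c * n.+1%:R - C <= y n) ->
  (forall n, (y n.+1 - y n) / n.+2%:R <= e n.+1 - e n) ->
  exists K, forall n, c * ln n.+2%:R - K <= e n.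
Proof.
move=> c0 yc ey.
(* [v] is nondecreasing: summation by parts leaves a gain [(y n + C) / (n.+1 * n.+2) >= c / n.+2],
   which covers the increment of [c * ln n.+2]. *)
pose v n := e n - (y n + C) / n.+1%:R - c * ln n.+2%:R.
have vS n : v n <= v n.+1.
  have h1 : ln n.+3%:R - ln n.+2%:R <= n.+2%:R^-1 :> R.
    rewrite -ln_div ?posrE ?ltr0n//; apply: le_trans (ln_leB1 _) _.
      by rewrite divr_gt0 ?ltr0n.
    by rewrite -[n.+3%:R]natr1 mulrDl divff ?pnatr_eq0// mul1r addrC addKr.
  have h2 : c / n.+2%:R <= (y n + C) / n.+1%:R - (y n + C) / n.+2%:R.
    have -> : (y n + C) / n.+1%:R - (y n + C) / n.+2%:R
            = (y n + C) / n.+1%:R / n.+2%:R.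
      rewrite -[n.+2%:R]natr1; field.
      by rewrite nat1r natr1 !pnatr_eq0.
    rewrite ler_pM2r ?invr_gt0 ?ltr0n// ler_pdivlMr ?ltr0n//.
    by have := yc n; lra.
  have h3 := ler_wpM2l (ltW c0) h1.
  have h4 := ey n.
  rewrite /v; move: h2 h3 h4.
  by move: (ln _) (ln _) (n.+1%:R^-1) (n.+2%:R^-1) => x3 x2 a b; lra.
have v0 n : v 0%N <= v n by elim: n => // n /le_trans; apply.
exists (- v 0%N) => n; have := v0 n; rewrite [leRHS]/v.
have : 0 <= (y n + C) / n.+1%:R.
  rewrite divr_ge0// -lerBDr sub0r; apply: le_trans (yc n).
  by rewrite -[leLHS]add0r lerD2r mulr_ge0// ltW.
move: (v 0%N) (_ / _) => v0' q; lra.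
Qed.
End Logarithm.

(** * Growth of the mean running maximum *)

Section States.
Variables (R : realType) (L0 : seq R).
Hypotheses (L0_pos : positive L0) (L0_nil : L0 <> [::]).

Let S0 : R := \sum_(x <- L0) x.

Definition lab_step (st : seq R * R) (w : bool) : seq R * R :=
  (next_list st.1 w, Num.max st.2 (bet_size (next_list st.1 w))).

(* The current list, and the largest of the sum of the initial list and of the
   bets placed so far, including the one called for by the current list. *)
Definition lab_state (s : seq bool) : seq R * R :=
  foldl lab_step (L0, S0) s.

Local Notation L s := (lab_state s).1.
Local Notation M s := (lab_state s).2.
Local Notation S s := (\sum_(x <- L s) x).

Lemma lab_state_rcons s w : lab_state (rcons s w) = lab_step (lab_state s) w.
Proof. by rewrite /lab_state foldl_rcons. Qed.

Lemma bet_size_le_sum l : positive l -> bet_size l <= \sum_(x <- l) x :> R.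
Proof.
move=> pos; rewrite -subr_ge0 -sum_cancel_ends positive_sum_ge0//.
by case: l pos => // x l /(positive_next_list (w := true)).
Qed.

Lemma lab_state_positive s : positive (L s).
Proof.
elim/last_ind: s => // s w IH; rewrite lab_state_rcons /=.
exact: positive_next_list.
Qed.

Lemma lab_state_max_gt0 s : 0 < M s.
Proof.
elim/last_ind: s => [|s w IH]; first exact: positive_sum_gt0.
by rewrite lab_state_rcons /= lt_max IH.
Qed.

Lemma bet_size_le_max s : bet_size (L s) <= M s.
Proof.
case/lastP: s => [|s w]; first exact: bet_size_le_sum.
by rewrite lab_state_rcons /= le_max lexx orbT.
Qed.

Lemma sum_rcons_le s w : S (rcons s w) <= S s + bet_size (L s).
Proof.
rewrite lab_state_rcons /= sum_next_list lerD2l; case: w => //.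
by have := bet_size_ge0 (lab_state_positive (s := s)); lra.
Qed.

Lemma max_rcons_le s w : M s <= M (rcons s w).
Proof. by rewrite lab_state_rcons /= le_max lexx. Qed.

(** Each coup adds at most one bet to the sum; starting the maximum at the initial sum settles the
    base case. *)
Lemma sum_le_max s : S s <= (size s).+1%:R * M s.
Proof.
elim/last_ind: s => [|s w IH]; first by rewrite mul1r.
apply: le_trans (sum_rcons_le s w) _; rewrite size_rcons -natr1 mulrDl mul1r.
apply: lerD; last exact: le_trans (bet_size_le_max s) (max_rcons_le s w).
apply: le_trans IH _; rewrite ler_wpM2l//; exact: max_rcons_le.
Qed.

(** The new sum is at most [n + 2] times the old maximum, as the bet just made is already counted
    there; then [ln x <= x - 1] at the ratio of the maxima. *)
Lemma max_increment s w :
  S (rcons s w) * (ln (M (rcons s w)) - ln (M s)) / (size s).+2%:R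
  <= M (rcons s w) - M s.
Proof.
have M0 := lab_state_max_gt0 s; have M1 := lab_state_max_gt0 (rcons s w).
have lnM : 0 <= ln (M (rcons s w)) - ln (M s).
  by rewrite subr_ge0 ler_ln ?posrE// max_rcons_le.
have SM : S (rcons s w) <= (size s).+2%:R * M s.
  apply: le_trans (sum_rcons_le s w) _; rewrite -natr1 mulrDl mul1r.
  by apply: lerD; [exact: sum_le_max|exact: bet_size_le_max].
rewrite ler_pdivrMr ?ltr0n//; apply: le_trans (ler_wpM2r lnM SM) _.
rewrite mulrC mulrCA mulrC ler_pM2r ?ltr0n//.
rewrite -ln_div ?posrE//; apply: le_trans (ler_wpM2r (ltW M0) (ln_leB1 _)) _.
  by rewrite divr_gt0.
by rewrite mulrBl mul1r divfK// gt_eqF.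
Qed.

(** Fairness: a win and a loss change the sum by opposite amounts. *)
Lemma mean_sum n : mean n (fun s => S s) = S0.
Proof.
elim: n => [|n IH]; first exact: mean0.
rewrite meanS -[RHS]IH; apply: eq_mean => s _.
by rewrite !lab_state_rcons /= !sum_next_list; lra.
Qed.

Lemma mean_length_potential n :
  mean n (fun s => length_potential (L s)) <= decay R ^+ n * length_potential L0.
Proof.
elim: n => [|n IH]; first by rewrite mean0 mul1r.
rewrite meanS exprS -mulrA.
apply: (@le_trans _ _ (mean n (fun s => decay R * length_potential (L s)))).
  apply: le_mean => s _; rewrite !lab_state_rcons /=.
  by have := length_potential_next_list (L s); lra.
by rewrite meanZ ler_wpM2l// /decay; lra.
Qed.

Let mean_max n := mean n (fun s => M s).
Let mean_sum_ln n := mean n (fun s => S s * ln (M s)).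

(** By fairness, replacing the new sum by the old one in front of [ln (M s)] does not change the
    average. *)
Lemma mean_max_increment n :
  (mean_sum_ln n.+1 - mean_sum_ln n) / n.+2%:R <= mean_max n.+1 - mean_max n.
Proof.
rewrite /mean_max /mean_sum_ln !meanS -!meanB mulrC -meanZ.
apply: le_mean => s sn.
have := lerD (max_increment s true) (max_increment s false).
rewrite sn !lab_state_rcons /= !sum_next_list.
set a := n.+2%:R^-1; move: (ln _) (ln _) (ln _) => x y z; nra.
Qed.

(** Pathwise entropy bound. The potential, at least 1 on nonempty lists, carries the error
    [decay ^- n], so that its mean stays bounded. *)
Lemma sum_ln_max_ge s n : size s = n ->
  S s * (- ln (decay R) *+ n - ln n.+1%:R)
    - decay R ^- n * length_potential (L s) <= S s * ln (M s).
Proof.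
move=> sn; have d0 : 0 < decay R by rewrite /decay; lra.
have [L_nil|/eqP L_nil] := eqVneq (L s) [::].
  by rewrite L_nil big_nil !mul0r mulr0 subr0.
have Sgt0 := positive_sum_gt0 (lab_state_positive (s := s)) L_nil.
have t0 : 0 < decay R ^- n by rewrite invr_gt0 exprn_gt0.
have lnM : ln (S s) - ln n.+1%:R <= ln (M s).
  rewrite -ln_div ?posrE ?ltr0n// ler_ln ?posrE ?divr_gt0 ?ltr0n//.
    by rewrite ler_pdivrMr ?ltr0n// mulrC -sn sum_le_max.
  exact: lab_state_max_gt0.
(* Gibbs' inequality: [S ln S >= S ln t + S - t] for [t = decay ^- n] *)
have lnS : - ln (decay R) *+ n - (decay R ^- n / S s - 1) <= ln (S s).
  have := ln_leB1 (divr_gt0 t0 Sgt0).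
  by rewrite ln_div ?posrE// lnV ?posrE ?exprn_gt0// lnXn// mulNrn; lra.
have phi1 := ler_wpM2l (ltW t0) (length_potential_ge1 L_nil).
have := ler_wpM2l (ltW Sgt0) (le_trans (lerB lnS (lexx _)) lnM).
rewrite !mulrBr mulr1 [_ * (_ / _)]mulrC divfK ?gt_eqF//.
by move: phi1 Sgt0; rewrite mulr1; lra.
Qed.

Lemma mean_sum_ln_ge : exists c C : R,
  0 < c /\ forall n, c * n.+1%:R - C <= mean_sum_ln n.
Proof.
have d0 : 0 < decay R by rewrite /decay; lra.
have S0gt0 : 0 < S0 by exact: positive_sum_gt0.
(* Half the entropy rate; the other half absorbs [ln n.+1], through [ln x <= x] at
   [x = a * n.+1]. *)
pose a := - ln (decay R) / 2.
have a0 : 0 < a.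
  by rewrite divr_gt0// oppr_gt0 ln_lt0// d0 /decay; lra.
exists (S0 * a), (S0 * (a *+ 2 - ln a) + length_potential L0).
split=> [|n]; first exact: mulr_gt0.
apply: le_trans (le_mean (@sum_ln_max_ge ^~ n)).
under eq_mean => s _ do rewrite mulrC.
rewrite meanB !meanZ mean_sum.
have phi : decay R ^- n * mean n (fun s => length_potential (L s))
    <= length_potential L0.
  by rewrite mulrC ler_pdivrMr ?exprn_gt0// mulrC mean_length_potential.
have lnn : ln n.+1%:R <= a * n.+1%:R - ln a.
  have := ln_sublinear (mulr_gt0 a0 (ltr0n R n.+1)).
  by rewrite lnM ?posrE ?ltr0n//; lra.
have dE : - ln (decay R) *+ n = a * n.+1%:R *+ 2 - a *+ 2.
  by rewrite /a -mulr_natr -[n.+1%:R]natr1; field.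
have := ler_wpM2l (ltW S0gt0) lnn; rewrite dE.
lra.
Qed.

Lemma mean_max_unbounded (K : R) : exists n, K <= mean_max n.
Proof.
have [c [C [c0 yc]]] := mean_sum_ln_ge.
have [K' Kle] := log_growth c0 yc mean_max_increment.
pose x := expR ((K + K') / c).
exists (Num.bound x); apply: le_trans (Kle _).
rewrite lerBrDr mulrC -ler_pdivrMr// -[leLHS]expRK ler_ln ?posrE ?expR_gt0//.
apply: le_trans (ltW (archi_boundP (expR_ge0 _))) _.
by rewrite ler_nat -addn2 leq_addr.
Qed.
End States.

(** * Comparison with the largest bet *)

Section MaxBet.
Variables (R : realType) (L0 : seq R) (s : nat -> bool).
Hypotheses (L0_pos : positive L0) (L0_nil : L0 <> [::]).

Lemma lab_state_mkseq n : (lab_state L0 (mkseq s n)).1 = lab_list L0 s n.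
Proof. by elim: n => // n IH; rewrite mkseqS lab_state_rcons /= IH. Qed.

Lemma lab_list_nil m n :
  (m <= n)%N -> lab_list L0 s m = [::] -> lab_list L0 s n = [::].
Proof.
by move=> /subnKC <- Lm; elim: (n - m)%N => [|k IH]; rewrite ?addn0// addnS /= IH.
Qed.

Lemma lt_lab_time n : lab_list L0 s n <> [::] -> (n.+1%:R%:E <= lab_time L0 s)%E.
Proof.
move=> Ln; apply: le_ereal_inf_tmp => _ [m /= Lm <-].
rewrite lee_fin ler_nat ltnNge; apply/negP => mn.
exact/Ln/(lab_list_nil mn).
Qed.

Lemma bet_size_le_max_bet n :
  ((bet_size (lab_list L0 s n))%:E <= lab_max_bet L0 s)%E.
Proof.
have le_max k : lab_list L0 s k <> [::] ->
    ((bet_size (lab_list L0 s k))%:E <= lab_max_bet L0 s)%E.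
  move=> Lk; apply: ereal_sup_ubound; exists k.+1 => //=.
  by split=> //; exact: lt_lab_time.
(* Once play has stopped, the default bet 0 is compared with the first bet. *)
have [Ln|/eqP/le_max//] := eqVneq (lab_list L0 s n) [::].
rewrite Ln /=; apply: le_trans (le_max 0%N L0_nil).
by rewrite lee_fin bet_size_ge0.
Qed.

(** The running maximum may be the initial sum, which need not be a bet; hence the subtraction. *)
Lemma lab_state_le_max_bet n :
  (((lab_state L0 (mkseq s n)).2 - \sum_(x <- L0) x)%:E <= lab_max_bet L0 s)%E.
Proof.
have S0_ge0 := positive_sum_ge0 L0_pos.
elim: n => [|n IH].
  rewrite subrr; apply: le_trans (bet_size_le_max_bet 0).
  by rewrite lee_fin bet_size_ge0.
rewrite mkseqS lab_state_rcons /= lab_state_mkseq.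
rewrite /Order.max; case: ifP => // _; apply: le_trans (bet_size_le_max_bet n.+1).
by rewrite lee_fin gerBl.
Qed.
End MaxBet.

Theorem corollary2 (R : realType) (d : measure_display) (T : measurableType d)
    (P : probability T R) (W : nat -> {RV P >-> bool}) (L0 : seq R)
    (hW : independent_coups 2^-1 W)
    (hL0 : L0 <> [::]) (hL0_pos : forall x, x \in L0 -> 0 < x) :
  (\int[P]_w lab_max_bet L0 (fun n => W n w) = +oo)%E.
Proof.
have M0 s : 0 <= (lab_state L0 s).2 - \sum_(x <- L0) x.
  elim/last_ind: s => [|s w IH]; first by rewrite subrr.
  by apply: le_trans IH _; rewrite lerD2r max_rcons_le.
apply: eq_infty => r.
have [n rn] := mean_max_unbounded hL0_pos hL0 (r + \sum_(x <- L0) x).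
(* The shifted running maximum is nonnegative and depends on [n] coups only, so its integral is a
   finite average. *)
apply: (@le_trans _ _ (\int[P]_w
    ((lab_state L0 (mkseq (fun i => W i w) n)).2 - \sum_(x <- L0) x)%:E)%E).
  rewrite (integral_coups hW _ M0) lee_fin meanB mean_cst.
  by rewrite lerBrDr.
apply: ge0_le_integral_nonmeasurable => w; first by rewrite lee_fin M0.
exact: lab_state_le_max_bet.
Qed.
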